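(* For any update set $R_A$ on $\Omega_P$, any base $B\in\Omega_P$ and any formula $\phi$ of public announcement logic such that $\Vdash_{B,R_A}\phi$, there is an effective update of $R_A$ by $\phi$ at $B$.
   Context: Fix a countably infinite initial set $P$ of atoms and a set $A$ of agents. Formulas of public announcement logic (PAL): $\phi::=p\mid\bot\mid\phi\to\phi\mid K_a\phi\mid[\phi]\phi$ with $p\in P$, $a\in A$. $\neg\phi:=\phi\to\bot$, $\phi\wedge\psi:=\neg(\phi\to\neg\psi)$. Bases. Let $Q\supseteq P$ be a countably infinite set of atoms. A base rule over $Q$ is $p_1,\dots,p_n\Rightarrow p$ with $\{p_1,\dots,p_n\}\subseteq Q$ finite (possibly empty) and $p\in Q$. A base is a countable set of base rules; $\Omega_Q$ is the set of bases over $Q$. $\overline{B}$ is the closure of the empty set under the rules of $B$. $B\in\Omega_Q$ is inconsistent if $\overline{B}=Q$, otherwise consistent. $S5$-modal relations. A binary relation $R_a$ on $\Omega_Q$ is an $S5$-modal relation if it is reflexive, transitive and Euclidean and for all $B$: (a) if $B$ is inconsistent, then there is an inconsistent $C$ with $R_aBC$, and every $D$ with $R_aBD$ is inconsistent; (b) if $B$ is consistent, every $C$ with $R_aBC$ is consistent; (c) for all $C$, if $R_aBC$, then for all consistent $D\supseteq B$ there is $E\supseteq C$ with $R_aDE$; (d) for all consistent $C$, if $R_aBC$, then for all $D\subseteq B$ there is $E\subseteq C$ with $R_aDE$. Reachability. Given $R_A=\{R_a\}_{a\in A}$, $C$ is reachable from $B$ (by $R_A$) if there is a finite chain of bases from $B$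 to $C$ with consecutive bases related by some $R_a$, $a\in A$. $C$ is reachable from $B$ using the sub/superset relation if there is a finite chain of bases from $B$ to $C$ with consecutive bases related by $\subseteq$ or $\supseteq$. Update sets. $R_A=\{R_a\}_{a\in A}$ is an update set on $\Omega_Q$ if: all $R_a$ are $S5$-modal relations; for all consistent $B,B'$ with $B'$ reachable from $B$ and $B'\subseteq B$, all $a\in A$ and all $C$, $R_aBC$ iff $R_aB'C$; and for every consistent $B$ there is a finite set $\pi(B)=\{\pi_1,\dots,\pi_n\}$ with each $\pi_i\subseteq\Omega_Q$, such that for all $i$ and $C,D\in\pi_i$, $D$ is reachable from $C$ using the sub/superset relation, and for all $C$, $C$ is reachable from $B$ by $R_A$ iff $C\in\pi_i$ for some $i$. The next two notions are defined simultaneously, by recursion on formulas. Effective updates. Let $R_A$ be an update set on $\Omega_Q$, $B\in\Omega_Q$, $\phi$ a formula. An update set $R'_A$ on $\Omega_{Q'}$ is an effective update of $R_A$ by $\phi$ at $B$ iff $Q'\supseteq Q$ and there is an assignment $C\mapsto C^+$ giving to every $C$ reachable from $B$ by $R_A$ a base $C^+\in\Omega_{Q'}$, $C^+\supseteq C$, such that: for all classical formulas $\theta$ (built with $\to,\bot$) with atoms in $Q$, $\Vdash_{C^+,R'_A}\theta$ iff $\Vdash_{C,R_A}\theta$; and for all $a\in A$ and all $C\ne D$ reachable from $B$ by $R_A$, $R'_aC^+D^+$ iff ($R_aCD$, $\Vdash_{C,R_A}\phi$ and $\Vdash_{D,R_A}\phi$). Such a $C^+$ is called an update of $C$ for $R'_A$.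 $R_A|\phi^B$ is the set of effective updates of $R_A$ by $\phi$ at $B$. For a sequence $\Delta=\phi_1;\dots;\phi_n$, $R_A|\Delta^B$ is obtained by iteration: update $R_A$ by $\phi_1$ at $B$, then the result by $\phi_2$ at the corresponding update of $B$, and so on; updates of a base for a member of $R_A|\Delta^B$ are the corresponding iterated updates. Support $\Vdash^{\Delta}_{B,R_A}$ ($\Delta$ a possibly empty finite sequence of formulas, omitted if empty): $\Vdash^{\Delta}_{B,R_A}p$ iff $p\in\overline{B}$; $\Vdash^{\Delta}_{B,R_A}\phi\to\psi$ iff $\phi\Vdash^{\Delta}_{B,R_A}\psi$; $\Vdash^{\Delta}_{B,R_A}\bot$ iff $\Vdash^{\Delta}_{B,R_A}p$ for all $p\in P$ (the initial set of atoms); if $\Delta$ is empty, $\Vdash_{B,R_A}K_a\phi$ iff $\Vdash_{B',R_A}\phi$ for all $B'$ with $R_aBB'$; if $\Delta$ is nonempty, $\Vdash^{\Delta}_{B,R_A}K_a\phi$ iff for all $C\supseteq B$, all $R'_A\in R_A|\Delta^{C}$ and all bases $C'$, if there are corresponding updates $C^+$ of $C$ and $C'^+$ of $C'$ for $R'_A$ with $R'_aC^+C'^+$, then $\Vdash^{\Delta}_{C',R_A}\phi$; $\Vdash^{\Delta}_{B,R_A}[\phi]\psi$ iff for all $C\supseteq B$, if $\Vdash^{\Delta}_{C,R_A}\phi$ then $\Vdash^{\Delta,\phi}_{C,R_A}\psi$; $\Gamma\Vdash^{\Delta}_{B,R_A}\phi$ iff for all $C\supseteq B$, if $\Vdash^{\Delta}_{C,R_A}\psi$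 for all $\psi\in\Gamma$ then $\Vdash^{\Delta}_{C,R_A}\phi$. *)

(* Defs.v *)
From Stdlib Require Import Relations.
From mathcomp Require Import all_boot finmap all_classical.

Set Implicit Arguments.
Unset Strict Implicit.
Unset Printing Implicit Defensive.

Local Open Scope classical_set_scope.

(* Sets of atoms are subsets of an ambient type [U]; it is
   meant to be uncountable, so that no countable set of atoms exhausts it and
   fresh atoms are always available. *)

Inductive formula (U A : Type) : Type :=
| Atom of U
| Bot
| Imp of formula U A & formula U A
| Know of A & formula U A
| Ann of formula U A & formula U A.

Arguments Bot {U A}.

Fixpoint atoms_in (U A : Type) (Q : set U) (phi : formula U A) : Prop :=
  match phi with
  | Atom p => Q p
  | Bot => True
  | Imp phi psi => atoms_in Q phi /\ atoms_in Q psi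
  | Know _ phi => atoms_in Q phi
  | Ann phi psi => atoms_in Q phi /\ atoms_in Q psi
  end.

Fixpoint classical (U A : Type) (phi : formula U A) : Prop :=
  match phi with
  | Atom _ | Bot => True
  | Imp phi psi => classical phi /\ classical psi
  | Know _ _ | Ann _ _ => False
  end.

Definition rule (U : choiceType) : Type := ({fset U} * U)%type.

Definition rule_over (U : choiceType) (Q : set U) (r : rule U) : Prop :=
  (forall q, q \in r.1 -> Q q) /\ Q r.2.

Notation base U := (set (rule U)).

Definition Omega (U : choiceType) (Q : set U) : set (base U) :=
  [set B | countable B /\ (forall r, B r -> rule_over Q r)].

Inductive derivable (U : choiceType) (B : base U) : set U :=
| derivable_rule (r : rule U) :
    B r -> (forall q, q \in r.1 -> derivable B q) -> derivable B r.2.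

Definition inconsistent (U : choiceType) (Q : set U) (B : base U) : Prop :=
  derivable B = Q.

Definition consistent (U : choiceType) (Q : set U) (B : base U) : Prop :=
  ~ inconsistent Q B.

Record S5_modal (U : choiceType) (Q : set U)
    (r : base U -> base U -> Prop) : Prop := {
  S5_on : forall B C, r B C -> Omega Q B /\ Omega Q C;
  S5_refl : forall B, Omega Q B -> r B B;
  S5_trans : forall B C D, r B C -> r C D -> r B D;
  S5_eucl : forall B C D, r B C -> r B D -> r C D;
  S5_a : forall B, Omega Q B -> inconsistent Q B ->
    (exists C, inconsistent Q C /\ r B C) /\
    (forall D, r B D -> inconsistent Q D);
  S5_b : forall B, Omega Q B -> consistent Q B ->
    forall C, r B C -> consistent Q C;
  S5_c : forall B C, r B C ->
    forall D, Omega Q D -> consistent Q D -> B `<=` D ->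
    exists E, [/\ Omega Q E, C `<=` E & r D E];
  S5_d : forall B C, consistent Q C -> r B C ->
    forall D, Omega Q D -> D `<=` B ->
    exists E, [/\ Omega Q E, E `<=` C & r D E]
}.

(* An agent-indexed family of relations on [Omega (atoms R)]. *)
Record relfam (U : choiceType) (A : Type) : Type := RelFam {
  atoms : set U;
  rel_of :> A -> base U -> base U -> Prop
}.

Definition reachable (U : choiceType) (A : Type) (R : relfam U A) :
    base U -> base U -> Prop :=
  clos_refl_trans (base U) (fun B C => exists a, R a B C).

Definition subsup_reachable (U : choiceType) (Q : set U) :
    base U -> base U -> Prop :=
  clos_refl_trans (base U) (fun B C =>
    [/\ Omega Q B, Omega Q C & B `<=` C \/ C `<=` B]).

Record update_set (U : choiceType) (A : Type) (P : set U)
    (R : relfam U A) : Prop := {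
  us_atoms : P `<=` atoms R;
  us_countable : countable (atoms R);
  us_infinite : infinite_set (atoms R);
  us_S5 : forall a, S5_modal (atoms R) (R a);
  us_sub : forall B B', Omega (atoms R) B -> Omega (atoms R) B' ->
    consistent (atoms R) B -> consistent (atoms R) B' ->
    reachable R B B' -> B' `<=` B ->
    forall a C, Omega (atoms R) C -> (R a B C <-> R a B' C);
  us_part : forall B, Omega (atoms R) B -> consistent (atoms R) B ->
    exists pi : set (set (base U)),
      [/\ finite_set pi,
          forall X, pi X -> X `<=` Omega (atoms R),
          forall X, pi X ->
            forall C D, X C -> X D -> subsup_reachable (atoms R) C D &
          forall C, Omega (atoms R) C ->
            (reachable R B C <-> exists X, pi X /\ X C)]
}.

(* The interpretation of a formula in the empty context. *)
Notation meaning U A := (relfam U A -> base U -> Prop).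

(* [f] is the assignment of updates to the bases reachable from [B]; its other
   values are irrelevant.  Support is abstracted: [T] interprets the classical
   formulas and [S] is the meaning of the announced formula.  This breaks the
   circularity between effective updates and support; both are instantiated
   with [supports] in [effective_update] below. *)
Record update_via (U : choiceType) (A : Type) (P : set U)
    (T : formula U A -> meaning U A) (S : meaning U A)
    (R : relfam U A) (B : base U) (R' : relfam U A)
    (f : base U -> base U) : Prop := {
  uv_update_set : update_set P R';
  uv_atoms : atoms R `<=` atoms R';
  uv_base : forall C, reachable R B C -> Omega (atoms R') (f C);
  uv_sup : forall C, reachable R B C -> C `<=` f C;
  uv_classical : forall C, reachable R B C ->
    forall theta, classical theta -> atoms_in (atoms R) theta ->
    (T theta R' (f C) <-> T theta R C);
  uv_rel : forall a C D, reachable R B C -> reachable R B D -> C <> D ->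
    (R' a (f C) (f D) <-> [/\ R a C D, S R C & S R D])
}.

(* [R'] is obtained from [R] by updating successively at (the update of) [B];
   [u C C'] says that [C'] is the corresponding iterated update of [C].  It is
   a partial function of [C]: at each stage only the bases reachable from the
   current update of [B] have an update. *)
Fixpoint iter_update (U : choiceType) (A : Type) (P : set U)
    (T : formula U A -> meaning U A) (Ss : seq (meaning U A))
    (R : relfam U A) (B : base U) (R' : relfam U A)
    (u : base U -> base U -> Prop) : Prop :=
  match Ss with
  | [::] => R' = R /\ forall C C', u C C' <-> C' = C
  | S1 :: Ss' => exists R1 f u1,
      [/\ update_via P T S1 R B R1 f,
          iter_update P T Ss' R1 (f B) R' u1 &
          forall C C', u C C' <-> reachable R B C /\ u1 (f C) C']
  end.

(* Support for classical formulas (the last two cases are never used); it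
   coincides with [supports] by [support_classical]. *)
Fixpoint csupport (U : choiceType) (A : Type) (P : set U)
    (phi : formula U A) (R : relfam U A) (B : base U) : Prop :=
  match phi with
  | Atom p => derivable B p
  | Bot => forall p, P p -> derivable B p
  | Imp phi psi => forall C, Omega (atoms R) C -> B `<=` C ->
      csupport P phi R C -> csupport P psi R C
  | Know _ _ | Ann _ _ => False
  end.

(* Support, with the formulas of the context replaced by their meanings so
   that the recursion is structural in the formula. *)
Fixpoint sem (U : choiceType) (A : Type) (P : set U) (phi : formula U A)
    (Ss : seq (meaning U A)) (R : relfam U A) (B : base U) : Prop :=
  match phi with
  | Atom p => derivable B p
  | Bot => forall p, P p -> derivable B p
  | Imp phi psi => forall C, Omega (atoms R) C -> B `<=` C ->
      sem P phi Ss R C -> sem P psi Ss R C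
  | Know a phi =>
      match Ss with
      | [::] => forall B', R a B B' -> sem P phi [::] R B'
      | _ :: _ => forall C, Omega (atoms R) C -> B `<=` C ->
          forall R' u, iter_update P (csupport P) Ss R C R' u ->
          forall C', Omega (atoms R) C' ->
          (exists D D', [/\ u C D, u C' D' & R' a D D']) ->
          sem P phi Ss R C'
      end
  | Ann phi psi => forall C, Omega (atoms R) C -> B `<=` C ->
      sem P phi Ss R C -> sem P psi (rcons Ss (sem P phi [::])) R C
  end.

Definition supports (U : choiceType) (A : Type) (P : set U)
    (Delta : seq (formula U A)) (R : relfam U A) (B : base U)
    (phi : formula U A) : Prop :=
  sem P phi [seq sem P psi [::] | psi <- Delta] R B.

Definition effective_update (U : choiceType) (A : Type) (P : set U)
    (R : relfam U A) (phi : formula U A) (B : base U) (R' : relfam U A) :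
    Prop :=
  exists f, update_via P (fun theta R C => supports P [::] R C theta)
              (fun R C => supports P [::] R C phi) R B R' f.

(* [R'] belongs to the iterated updates of [R] by [Delta] at [B], with [u] the
   relation between bases and their iterated updates. *)
Definition effective_updates (U : choiceType) (A : Type) (P : set U)
    (R : relfam U A) (Delta : seq (formula U A)) (B : base U)
    (R' : relfam U A) (u : base U -> base U -> Prop) : Prop :=
  iter_update P (fun theta R C => supports P [::] R C theta)
    [seq (fun R C => supports P [::] R C phi) | phi <- Delta] R B R' u.

Section SupportClauses.
Variables (U : choiceType) (A : Type) (P : set U).
Implicit Types (phi psi theta : formula U A) (R : relfam U A) (B : base U).

Lemma support_classical theta Delta R B : classical theta ->
  supports P Delta R B theta <-> csupport P theta R B.
Proof.
rewrite /supports; elim: theta B => //= phi IHphi psi IHpsi B [cphi cpsi].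
by split=> H C QC BC /(IHphi _ cphi) /(H C QC BC) /(IHpsi _ cpsi).
Qed.

Lemma eq_update_via (T T' : formula U A -> meaning U A) S R B R' f :
  (forall theta R B, classical theta -> T theta R B <-> T' theta R B) ->
  update_via P T S R B R' f -> update_via P T' S R B R' f.
Proof.
move=> TT' [h1 h2 h3 h4 h5 h6]; split=> // C BC theta cth ath.
have [h h'] := h5 C BC theta cth ath.
have [t1 t2] := TT' theta R' (f C) cth.
have [t3 t4] := TT' theta R C cth.
by split; [move=> /t2/h/t3 | move=> /t4/h'/t1].
Qed.

Lemma eq_iter_update (T T' : formula U A -> meaning U A) Ss R B R' u :
  (forall theta R B, classical theta -> T theta R B <-> T' theta R B) ->
  iter_update P T Ss R B R' u -> iter_update P T' Ss R B R' u.
Proof.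
move=> TT'; elim: Ss R B u => //= S Ss IH R B u [R1 [f [u1 [h1 h2 h3]]]].
by exists R1, f, u1; split=> //; [exact: eq_update_via h1 | exact: IH].
Qed.

Lemma support_atom Delta R B p :
  supports P Delta R B (Atom A p) <-> derivable B p.
Proof. by []. Qed.

Lemma support_bot Delta R B :
  supports P Delta R B Bot <-> forall p, P p -> supports P Delta R B (Atom A p).
Proof. by []. Qed.

Lemma support_imp Delta R B phi psi :
  supports P Delta R B (Imp phi psi) <->
  forall C, Omega (atoms R) C -> B `<=` C ->
    supports P Delta R C phi -> supports P Delta R C psi.
Proof. by []. Qed.

Lemma support_know0 R B a phi :
  supports P [::] R B (Know a phi) <->
  forall B', R a B B' -> supports P [::] R B' phi.
Proof. by []. Qed.

Lemma support_know Delta R B a phi : Delta <> [::] ->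
  supports P Delta R B (Know a phi) <->
  forall C, Omega (atoms R) C -> B `<=` C ->
  forall R' u, effective_updates P R Delta C R' u ->
  forall C', Omega (atoms R) C' ->
  (exists D D', [/\ u C D, u C' D' & R' a D D']) -> supports P Delta R C' phi.
Proof.
case: Delta => // psi Delta _; split=> H C QC BC R' u hu; apply: (H C QC BC).
  by apply: eq_iter_update hu => theta R1 B1; exact: support_classical.
by apply: eq_iter_update hu => theta R1 B1 /support_classical->.
Qed.

Lemma support_ann Delta R B phi psi :
  supports P Delta R B (Ann phi psi) <->
  forall C, Omega (atoms R) C -> B `<=` C ->
    supports P Delta R C phi -> supports P (rcons Delta phi) R C psi.
Proof. by rewrite /supports map_rcons. Qed.

End SupportClauses.

(* Main.v *)
Require Import Defs.
From Stdlib Require Import Relations.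
From mathcomp Require Import all_boot finmap all_classical.

Set Implicit Arguments.
Unset Strict Implicit.
Unset Printing Implicit Defensive.

Local Open Scope classical_set_scope.

(** The updated bases differ from the given ones only by loops, rules [u => u]
    on fresh atoms.  A loop never changes what is derivable, so loops serve as
    tags: they can be added to or removed from a base freely, and they leave
    consistency and classical support untouched.

    Fresh atoms [q (s, b)] are indexed by bit strings [s] and bits [b], and each
    base [C] over [P] gets a code, a set of bit strings.  The update [encode C]
    carries, for each [s], exactly one of the two loops with index [s]; the bit
    [b] tells whether [s] is in the code of [C].  For a set [h] of strings,
    swapping the loops on [(s, true)] and [(s, false)] for every [s] in [h] is
    an automorphism of the inclusion order on sets of tags.  The new relation
    of an agent [a] makes [E] and [F] related when both or neither are
    consistent and the tags of [F] arise from those of [E] by a swap in the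
    group [G_a] generated by the symmetric differences of the codes of [C] and
    [D], over all pairs [C], [D] that are related by [R_a] and support the
    announced formula.

    Being orbit relations of order automorphisms, these relations satisfy the
    lifting conditions along supersets and subsets ([flip_S5]).  The swaps are
    involutions, so a swap which makes a set of tags smaller fixes it
    ([flip_sub_id]); hence comparable reachable bases have the same tags and
    the same successors.  Finally, the codes are linearly independent over the
    field with two elements: the code of [C] plus the code of [D] lies in [G_a]
    only if [C = D] or the pair is one of those that generate [G_a]
    ([shift_code]).  So [encode C] and [encode D] are related exactly when they
    should be ([flip_encode]).

    There may be continuum many bases but only countably many fresh atoms, so
    codes cannot be single tags.  Taking as code the set of finite prefixes of
    an infinite bit sequence that describes the base makes the codes
    almost disjoint, which gives the independence.

    Classical formulas have the same support at [C] and at [encode C] because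
    classical support at a base depends only on the sets of atoms of [P] that
    are traces of sets closed under its rules ([csupport_same_closed]). *)

(** * Countability *)

Lemma countableU (T : Type) (X Y : set T) :
  countable X -> countable Y -> countable (X `|` Y).
Proof.
move=> cX cY; rewrite -bigcup2E; apply: bigcup_countable => // -[|[|n]] _ //=.
Qed.

Lemma countable_rules (U : choiceType) (P : set U) :
  countable P -> countable [set r | rule_over P r].
Proof.
move=> /countable_injP[e e_inj]; apply/countable_injP.
have map_e_inj (s s' : seq U) : (forall q, q \in s -> P q) ->
    (forall q, q \in s' -> P q) -> map e s = map e s' -> s = s'.
  elim: s s' => [|x s IH] [|y s'] //= Ps Ps' [exy es].
  rewrite (e_inj x y) ?inE //; first last.
  - by apply: Ps'; rewrite inE eqxx.
  - by apply: Ps; rewrite inE eqxx.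
  by rewrite (IH s') // => q qs; [apply: Ps|apply: Ps']; rewrite inE qs orbT.
exists (fun r : rule U => choice.pickle (map e r.1, e r.2)).
move=> [S p] [S' p'] /set_mem[/= PS Pp] /set_mem[/= PS' Pp'].
move=> /(pcan_inj choice.pickleK)[eS ep].
by rewrite (e_inj p p') ?inE //; congr pair; apply/val_inj/map_e_inj.
Qed.

Lemma fresh_embedding (U : choiceType) (I : countType) (P : set U) :
  ~ countable [set: U] -> countable P ->
  exists2 q : I -> U, injective q & forall n, ~ P (q n).
Proof.
move=> ncU cP.
have : infinite_set (~` P).
  move=> /finite_set_countable cCP; apply: ncU.
  by rewrite -(setUv P); exact: countableU.
move=> /infiniteP/card_leP[f].
exists (fun i => val (f (to_setT (choice.pickle i)))).
  move=> i j /val_inj/(inj (in_setT _) (in_setT _))/(congr1 val)/=.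
  exact: (pcan_inj choice.pickleK).
by move=> n; have := set_mem (valP (f (to_setT (choice.pickle n)))).
Qed.

(** * Derivability *)

Section Derivability.
Variable U : choiceType.
Implicit Types (B C D E F : base U) (V : set U) (r : rule U) (P Q : set U).

Definition closed_under B V :=
  forall r, B r -> (forall q, q \in r.1 -> V q) -> V r.2.

Lemma closed_derivable B : closed_under B (derivable B).
Proof. by move=> r; exact: derivable_rule. Qed.

Lemma derivable_min B V : closed_under B V -> derivable B `<=` V.
Proof. by move=> clV p; elim=> r Br _; exact: clV. Qed.

Lemma closed_underS B C V : B `<=` C -> closed_under C V -> closed_under B V.
Proof. by move=> BC clV r /BC; exact: clV. Qed.

Lemma sub_derivable B C : B `<=` C -> derivable B `<=` derivable C.
Proof.
move=> BC; apply: derivable_min; apply: (closed_underS BC).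
exact: closed_derivable.
Qed.

Lemma derivable_over Q B : Omega Q B -> derivable B `<=` Q.
Proof. by move=> [_ QB]; apply: derivable_min => r /QB[]. Qed.

Lemma sub_consistent Q B D :
  Omega Q D -> B `<=` D -> consistent Q D -> consistent Q B.
Proof.
move=> QD BD cD iB; apply: cD; apply/seteqP; split.
  exact: derivable_over QD.
by rewrite -iB; exact: sub_derivable.
Qed.

Lemma OmegaS P Q B : P `<=` Q -> Omega P B -> Omega Q B.
Proof.
move=> PQ [cB PB]; split=> // r /PB[Pr1 Pr2].
by split=> [q /Pr1/PQ|]; last exact: PQ.
Qed.

Lemma OmegaU Q B C : Omega Q B -> Omega Q C -> Omega Q (B `|` C).
Proof.
move=> [cB QB] [cC QC]; split; first exact: countableU.
by move=> r [/QB|/QC].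
Qed.

Lemma subsup_reachable_all Q C D :
  Omega Q C -> Omega Q D -> subsup_reachable Q C D.
Proof.
move=> QC QD; apply: (rt_trans _ _ _ (C `|` D)); apply: rt_step.
  by split=> //; [exact: OmegaU | left; exact: subsetUl].
by split=> //; [exact: OmegaU | right; exact: subsetUr].
Qed.

End Derivability.

(** * Classical support depends only on the closed sets of initial atoms *)

Section ClassicalSupport.
Variables (U : choiceType) (A : Type) (P : set U).
Hypothesis P_countable : countable P.
Implicit Types (E F : base U) (V : set U).

(** For [E] over [P], a set is closed under [E] if and only if its trace on [P]
    is.  So this says that the subsets of [P] closed under [E] are exactly the
    traces on [P] of the sets closed under [E']. *)
Definition same_closed E E' :=
  (forall V, closed_under E' V -> closed_under E V) /\
  (forall V, V `<=` P -> closed_under E V ->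
     exists2 V', closed_under E' V' & V' `&` P = V).

Lemma same_closed_derivable E E' p : Omega P E -> same_closed E E' -> P p ->
  derivable E p <-> derivable E' p.
Proof.
move=> PE [EE' E'E] Pp; split.
  by apply: derivable_min; apply: EE'; exact: closed_derivable.
have [V' clV' V'P] := E'E _ (derivable_over PE) (@closed_derivable _ E).
by move=> /(derivable_min clV') V'p; rewrite -V'P.
Qed.

(** The base over [P] which stands for [E'] among the supersets of a base over
    [P]. *)
Definition consequences E' : base U :=
  [set r | rule_over P r /\
    forall V, closed_under E' V -> closed_under [set r] V].

Lemma Omega_consequences E' : Omega P (consequences E').
Proof.
split; last by move=> r [].
apply: sub_countable (countable_rules P_countable).
by apply: subset_card_le => r [].
Qed.

(** This is compactness: an atom in the [E']-closure of [V] is in the closure of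
    a finite subset [S] of [V].  If it is in [P], then the rule with premises
    [S] and that atom as conclusion is one of the consequences. *)
Lemma same_closed_consequences E' : same_closed (consequences E') E'.
Proof.
split=> [V clV r [_ /(_ V clV)]|V VP clV]; first exact.
pose V' : set U := [set u | exists2 S : {fset U}, (forall q, q \in S -> V q) &
  forall Y, closed_under E' Y -> (forall q, q \in S -> Y q) -> Y u].
exists V'.
  move=> r E'r rV'.
  pose good q (S : {fset U}) := (forall s, s \in S -> V s) /\
    forall Y, closed_under E' Y -> (forall s, s \in S -> Y s) -> Y q.
  have /choice[g gP] (q : U) : exists S : {fset U}, q \in r.1 -> good q S.
    case: (boolP (q \in r.1)) => [/rV'[S SV Sq]|_]; last by exists fset0.
    by exists S.
  exists (\bigcup_(q <- r.1) g q)%fset.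
    by move=> s /bigfcupP[q /andP[qr _]]; apply: (gP q qr).1.
  move=> Y clY gY; apply: (clY r E'r) => q qr; apply: (gP q qr).2 clY _ => s sg.
  by apply: gY; apply/bigfcupP; exists q; rewrite ?qr.
apply/seteqP; split=> [p [[S SV Sp] Pp]|p Vp].
  apply: (clV (S, p)) => //; split; first by split=> // q /SV/VP.
  by move=> Y clY r -> SY; apply: Sp.
split; last exact: VP.
by exists [fset p]%fset => [q|Y _]; [rewrite inE => /eqP->|apply; rewrite inE].
Qed.

Lemma same_closedU E E' F : Omega P F -> E `<=` F ->
  same_closed E E' -> same_closed F (F `|` E').
Proof.
move=> [_ PF] EF [EE' E'E]; split=> [V|V VP clV].
  by apply: closed_underS; exact: subsetUl.
have [V' clV' V'P] := E'E V VP (closed_underS EF clV).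
exists V' => // r [Fr|E'r]; last exact: clV'.
have [Pr1 Pr2] := PF r Fr; move=> rV'.
have : V r.2 by apply: clV => // q qr; rewrite -V'P; split; auto.
by rewrite -V'P => -[].
Qed.

(** For an implication, the supersets of [E] and those of [E'] have to be
    matched: [F] over [P] is matched with [F] together with [E'], and conversely
    a superset of [E'] is matched with the base of its consequences. *)
Lemma csupport_same_closed (theta : formula U A) (R R' : relfam U A) E E' :
  atoms R = P -> P `<=` atoms R' -> classical theta -> atoms_in P theta ->
  Omega P E -> Omega (atoms R') E' -> same_closed E E' ->
  csupport P theta R E <-> csupport P theta R' E'.
Proof.
move=> RP PR'; elim: theta E E' => //=.
- by move=> p E E' _ Pp PE _ EE'; exact: same_closed_derivable.
- move=> E E' _ _ PE _ EE'.
  by split=> H p Pp; [apply/(same_closed_derivable PE EE')|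
    apply/(same_closed_derivable PE EE')]; auto.
move=> t1 IH1 t2 IH2 E E' [ct1 ct2] [at1 at2] PE R'E' EE'; rewrite RP; split.
  move=> H F' R'F' E'F' t1F'.
  have PF := Omega_consequences F'; have FF' := same_closed_consequences F'.
  apply/(IH2 _ _ ct2 at2 PF R'F' FF'); apply: H => //.
    move=> r Er; split; first exact: PE.2.
    move=> V clV; apply: (@closed_underS _ _ E) => [_ ->//|].
    by apply: EE'.1; exact: closed_underS clV.
  exact/(IH1 _ _ ct1 at1 PF R'F' FF').
move=> H F PF EF t1F.
have R'F' : Omega (atoms R') (F `|` E').
  by apply: OmegaU => //; exact: OmegaS PF.
have FF' := same_closedU PF EF EE'.
apply/(IH2 _ _ ct2 at2 PF R'F' FF'); apply: H => //.
exact/(IH1 _ _ ct1 at1 PF R'F' FF').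
Qed.

End ClassicalSupport.

(** * Tags *)

Section Tags.
Variables (U : choiceType) (N : countType) (q : N -> U).
Hypothesis q_inj : injective q.
Implicit Types (B C D E : base U) (t : set N).

Definition loop (u : U) : rule U := ([fset u]%fset, u).

Definition tags B : set N := [set n | B (loop (q n))].

Definition retag B t : base U :=
  [set r | B r /\ ~ (exists n, r = loop (q n))] `|`
  [set loop (q n) | n in t].

Lemma loop_inj m n : loop (q m) = loop (q n) -> m = n.
Proof. by move=> /(congr1 snd)/q_inj. Qed.

Lemma tags_retag B t : tags (retag B t) = t.
Proof.
apply/seteqP; split=> n; last by move=> tn; right; exists n.
by move=> [[_ []]|[m tm /loop_inj<-]//]; exists n.
Qed.

Lemma sub_retag B t : tags B `<=` t -> B `<=` retag B t.
Proof.
move=> Bt r Br; have [[n rE]|nr] := pselect (exists n, r = loop (q n)).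
  by right; exists n => //; apply: Bt; rewrite /tags /= -rE.
by left.
Qed.

Lemma retag_sub B t : t `<=` tags B -> retag B t `<=` B.
Proof. by move=> tB r [[]//|[n /tB Bn <-]]. Qed.

(** Every set is closed under a loop. *)
Lemma closed_retag B t : closed_under (retag B t) = closed_under B.
Proof.
apply/funext => V; apply/propext; split=> clV r.
  move=> Br; have [[n ->]|nr] := pselect (exists n, r = loop (q n)).
    by apply; rewrite inE.
  by apply: clV; left.
by move=> [[Br _]|[n _ <-]]; [exact: clV | apply; rewrite inE].
Qed.

Lemma derivable_retag B t : derivable (retag B t) = derivable B.
Proof.
apply/seteqP; split; apply: derivable_min.
  by rewrite closed_retag; exact: closed_derivable.
by rewrite -(closed_retag B t); exact: closed_derivable.
Qed.

Lemma Omega_retag Q B t : (forall n, Q (q n)) -> Omega Q B ->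
  Omega Q (retag B t).
Proof.
move=> Qq [cB QB]; split.
  apply: countableU; last first.
    by apply: (sub_countable (card_image_le _ _)); exact: countableP.
  by apply: sub_countable cB; apply: subset_card_le => r [].
move=> r [[/QB//]|[n _ <-]]; split=> //= u; rewrite inE => /eqP->; exact: Qq.
Qed.

Lemma tags_fresh P B : (forall n, ~ P (q n)) -> Omega P B -> tags B = set0.
Proof. by move=> Pq [_ PB]; apply/seteqP; split=> // n /PB[_ /Pq]. Qed.

End Tags.

(** * Independent codes *)

Section Codes.
Variables (T : eqType) (I : Type) (code : T -> I -> bool) (D : set T).

(** Codes are vectors over the field with two elements; this is the sum of the
    differences along the pairs in [l]. *)
Definition shift (l : seq (T * T)) (s : I) : bool :=
  \big[addb/false]_(x <- l) (code x.1 s (+) code x.2 s).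

(** This implies that the codes of the points in [D] are linearly independent:
    in a sum of finitely many of them, each one has an index of its own. *)
Definition isolating := forall x (l : seq T), D x ->
  exists2 s, code x s & forall y, y \in l -> D y -> y <> x -> ~~ code y s.

Lemma shift_cat l l' : shift (l ++ l') = fun s => shift l s (+) shift l' s.
Proof. by apply/funext => s; rewrite /shift big_cat. Qed.

Lemma shift_rem z l s : z \in l ->
  shift l s = (code z.1 s (+) code z.2 s) (+) shift (rem z l) s.
Proof. by move=> /perm_to_rem zl; rewrite /shift (perm_big _ zl) big_cons. Qed.

(** Some pair [z] in [l] joins [x] to another point [x']: otherwise the two
    sides of the equation would differ at an index that isolates [x] from [y]
    and from the other points in [l].  Removing [z] from [l] turns the equation
    for [x] and [y] into one for [x'] and [y], so induction on the length of [l]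
    leads from [x] to [y] through related points. *)
Lemma shift_code (e : T -> T -> Prop) l x y : isolating ->
  (forall x y, e x y -> D x /\ D y) ->
  (forall x y, e x y -> e y x) ->
  (forall x y z, e x y -> e y z -> e x z) ->
  (forall z, z \in l -> e z.1 z.2) -> D x -> D y -> x <> y ->
  (forall s, shift l s = code x s (+) code y s) -> e x y.
Proof.
move=> iso eD e_sym e_trans.
have [n] := ubnP (size l); elim: n => // n IH in l x *.
rewrite ltnS => l_n le Dx Dy xy lxy.
have step x' : e x x' ->
    (exists2 z, z \in l &
      forall s, code z.1 s (+) code z.2 s = code x s (+) code x' s) -> e x y.
  move=> exx' [z zl zE]; have [<-//|x'y] := pselect (x' = y).
  apply: (e_trans _ _ _ exx'); apply: (IH (rem z l)) => //.
  - by rewrite size_rem // prednK //; case: (l) zl.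
  - by move=> w /mem_rem/le.
  - by case/eD: exx'.
  move=> s; have := lxy s; rewrite (shift_rem s zl) zE.
  by case: (code x s) (code x' s) (code y s) (shift _ s) => [] [] [] [].
have [/hasP[z zl]|] := boolP (has (fun z => (z.1 == x) (+) (z.2 == x)) l).
  have := le z zl; case: z zl => z1 z2 /= zl ez.
  have [zx|_] := eqVneq z1 x => /= [_|/eqP zx]; subst x.
    by apply: (step z2) => //; exists (z1, z2).
  apply: (step z1); first exact: e_sym.
  by exists (z1, z2) => // s; rewrite /= addbC.
move=> /hasPn no_x.
have [s xs ls] := iso x (y :: unzip1 l ++ unzip2 l) Dx.
have : shift l s = true.
  rewrite lxy xs (negbTE (ls y _ _ _)) ?inE ?eqxx //; exact: nesym.
rewrite /shift big_seq big1 // => z zl; have := no_x z zl.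
have [Dz1 Dz2] := eD _ _ (le z zl).
have [zx1|/eqP zx1] := eqVneq z.1 x;
    have [zx2|/eqP zx2] := eqVneq z.2 x => //= _.
  by rewrite zx1 zx2 addbb.
by rewrite !(negbTE (ls _ _ _ _)) // inE mem_cat map_f ?orbT.
Qed.

End Codes.

Section Prefixes.
Variables (T : eqType) (chi : T -> nat -> bool).

Definition prefix_code (x : T) (s : seq bool) : bool :=
  s == mkseq (chi x) (size s).

(** A prefix of [chi x] that is long enough is not a prefix of any of finitely
    many other sequences. *)
Lemma prefix_code_isolating (D : set T) :
  (forall x y, D x -> D y -> chi x =1 chi y -> x = y) ->
  isolating prefix_code D.
Proof.
move=> chi_inj x l Dx.
have [k kP] : exists k, forall y, y \in l -> D y -> y <> x ->
    exists2 i, i < k & chi y i <> chi x i.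
  elim: l => [|z l [k IH]]; first by exists 0.
  have [[i zi]|Nz] := pselect (exists i, chi z i <> chi x i).
    exists (maxn k i.+1) => y; rewrite inE => /orP[/eqP-> _ _|yl Dy yx].
      by exists i => //; rewrite leq_max leqnn orbT.
    have [j jk yj] := IH y yl Dy yx.
    by exists j => //; rewrite leq_max jk.
  exists k => y; rewrite inE => /orP[/eqP-> Dz zx|yl]; last exact: IH.
  exfalso; apply: zx; apply: chi_inj => // i; apply: contrapT => zi.
  by apply: Nz; exists i.
exists (mkseq (chi x) k); first by rewrite /prefix_code size_mkseq.
move=> y yl Dy yx; have [i ik yi] := kP y yl Dy yx.
apply/eqP; rewrite size_mkseq => /(congr1 (nth false ^~ i)).
by rewrite !nth_mkseq // => /esym.
Qed.

End Prefixes.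

Lemma isolating_codes (U : choiceType) (P : set U) : countable P ->
  exists code : base U -> seq bool -> bool, isolating code (Omega P).
Proof.
move=> /countable_rules/countable_injP[e e_inj].
pose chi (C : base U) k := `[< exists2 r, C r & e r = k >].
have code_sub C D : Omega P C -> Omega P D -> chi C =1 chi D -> C `<=` D.
  move=> [_ PC] [_ PD] CD r Cr.
  have : chi C (e r) by apply/asboolP; exists r.
  rewrite CD => /asboolP[r' Dr' er'].
  by rewrite -(e_inj r' r) //; apply/mem_set; [exact: PD | exact: PC].
exists (prefix_code chi); apply: prefix_code_isolating => C D PC PD CD.
by apply/seteqP; split; apply: code_sub => // k; rewrite CD.
Qed.

(** * The updated relations *)

Section Update.
Variables (U : choiceType) (A : Type) (P : set U) (R : relfam U A).
Hypotheses (P_countable : countable P) (P_infinite : infinite_set P).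
Hypotheses (R_on_P : atoms R = P) (R_update_set : update_set P R).
Variable S : base U -> Prop.

Variable code : base U -> seq bool -> bool.
Hypothesis code_isolating : isolating code (Omega P).
Variable q : seq bool * bool -> U.
Hypotheses (q_inj : injective q) (q_fresh : forall n, ~ P (q n)).
Implicit Types (B C D E F : base U).

Definition retained a C D := [/\ R a C D, S C & S D].

(** [h] is the characteristic function of the set of strings at which the two
    possible tags are swapped. *)
Definition flip (h : seq bool -> bool) (t : set (seq bool * bool)) :
    set (seq bool * bool) :=
  [set n | t (n.1, n.2 (+) h n.1)].

Definition flip_family : relfam U A :=
  RelFam (P `|` range q) (fun a E F =>
    [/\ Omega (P `|` range q) E, Omega (P `|` range q) F,
        inconsistent (P `|` range q) E <-> inconsistent (P `|` range q) F &
        exists2 l, (forall z, z \in l -> retained a z.1 z.2) &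
          tags q F = flip (shift code l) (tags q E)]).

Definition encode C : base U := retag q C [set n | n.2 = code C n.1].

Let Q := P `|` range q.

Lemma Qq n : Q (q n). Proof. by right; exists n. Qed.

Lemma flipK h : involutive (flip h).
Proof. by move=> t; apply/funext => -[s b]; rewrite /flip /= addbK. Qed.

Lemma flipS h t t' : t `<=` t' -> flip h t `<=` flip h t'.
Proof. by move=> tt' n /tt'. Qed.

Lemma flip_comp h h' t : flip h (flip h' t) = flip (fun s => h s (+) h' s) t.
Proof. by apply/funext => -[s b]; rewrite /flip /= addbA. Qed.

(** [flip h] is a monotone involution, so it also maps the inclusion to the
    opposite one. *)
Lemma flip_sub_id h t : flip h t `<=` t -> flip h t = t.
Proof.
by move=> ht; apply/seteqP; split=> //; rewrite -{1}(flipK h t); exact: flipS.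
Qed.

Lemma retained_on a C D : retained a C D -> Omega P C /\ Omega P D.
Proof.
by case=> /(S5_on (us_S5 R_update_set a)); rewrite R_on_P.
Qed.

Lemma retained_sym a C D : retained a C D -> retained a D C.
Proof.
move=> CD; have [PC _] := retained_on CD; case: CD => RCD SC SD; split=> //.
have RS5 := us_S5 R_update_set a; apply: (S5_eucl RS5 RCD).
by apply: (S5_refl RS5); rewrite R_on_P.
Qed.

Lemma retained_trans a C D E :
  retained a C D -> retained a D E -> retained a C E.
Proof.
move=> [CD SC _] [DE _ SE]; split=> //.
exact: (S5_trans (us_S5 R_update_set a) CD) DE.
Qed.

Lemma inconsistent_retag E t :
  inconsistent Q (retag q E t) <-> inconsistent Q E.
Proof. by rewrite /inconsistent derivable_retag. Qed.

Lemma flip_refl a E : Omega Q E -> flip_family a E E.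
Proof.
move=> QE; split=> //; exists [::] => //.
by apply/funext => -[s b]; rewrite /flip /= /shift big_nil addbF.
Qed.

(** The common core of the two lifting conditions: flips are order
    automorphisms, and a base can be given any tags at no cost, so it is enough
    to retag [F] with the flipped tags of [D]. *)
Lemma flip_lift a E F D : flip_family a E F -> Omega Q D ->
  consistent Q E -> consistent Q D ->
  exists2 h, tags q F = flip h (tags q E) &
    flip_family a D (retag q F (flip h (tags q D))).
Proof.
move=> [QE QF EF [l lP lE]] QD cE cD; exists (shift code l) => //.
split=> //; first exact: Omega_retag Qq QF.
  by rewrite inconsistent_retag -EF; split=> [/cD|/cE].
by exists l; rewrite // tags_retag.
Qed.

Lemma flip_S5 a : S5_modal Q (flip_family a).
Proof.
split.
- by move=> E F [].
- exact: flip_refl.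
- move=> E F G [QE QF EF [l lP lE]] [_ QG FG [l' l'P l'E]]; split=> //.
    exact: iff_trans FG.
  exists (l' ++ l) => [z|]; first by rewrite mem_cat => /orP[/l'P|/lP].
  by rewrite l'E lE flip_comp shift_cat.
- move=> E F G [QE QF EF [l lP lE]] [_ QG EG [l' l'P l'E]]; split=> //.
    exact: iff_trans (iff_sym EF) EG.
  exists (l' ++ l) => [z|]; first by rewrite mem_cat => /orP[/l'P|/lP].
  by rewrite l'E -[tags q E](flipK (shift code l)) -lE flip_comp shift_cat.
- move=> E QE iE; split; last by move=> F [_ _ [EF _] _]; exact: EF.
  by exists E; split=> //; exact: flip_refl.
- by move=> E QE cE F [_ _ [_ FE] _] /FE.
- move=> E F EF D QD cD ED; have [_ QF _ _] := EF.
  have [h FE FD] := flip_lift EF QD (sub_consistent QD ED cD) cD.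
  exists (retag q F (flip h (tags q D))); split=> //.
    exact: Omega_retag Qq QF.
  by apply: sub_retag; rewrite FE; apply: flipS => n; exact: ED.
move=> E F cF EF D QD DE; have [QE QF [iEF _] _] := EF.
have cE : consistent Q E by move=> /iEF/cF.
have [h FE FD] := flip_lift EF QD cE (sub_consistent QE DE cE).
exists (retag q F (flip h (tags q D))); split=> //.
  exact: Omega_retag Qq QF.
by apply: retag_sub; rewrite FE; apply: flipS => n; exact: DE.
Qed.

Lemma reachable_flip E F : reachable flip_family E F ->
  exists h, tags q F = flip h (tags q E).
Proof.
elim=> {E F} [E F [a [_ _ _ [l _ lE]]]|E|E F G _ [h hE] _ [h' h'E]].
- by exists (shift code l).
- exists (fun=> false).
  by apply/funext => -[s b]; rewrite /flip /= addbF.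
- by exists (fun s => h' s (+) h s); rewrite h'E hE flip_comp.
Qed.

Lemma flip_update_set : update_set P flip_family.
Proof.
split.
- exact: subsetUl.
- apply: countableU => //.
  by apply: (sub_countable (card_image_le _ _)); exact: countableP.
- by apply: sub_infinite_set P_infinite; exact: subsetUl.
- exact: flip_S5.
- move=> E E' QE QE' cE cE' /reachable_flip[h hE] E'E a C QC.
  have tE : tags q E' = tags q E.
    rewrite hE; apply: flip_sub_id; rewrite -hE => n; exact: E'E.
  have EE' : inconsistent Q E <-> inconsistent Q E' by split=> [/cE|/cE'].
  by rewrite /= tE; split=> -[_ _ EC lP]; split=> //; rewrite -EC; split=> /EE'.
- move=> E QE cE; exists [set [set C | reachable flip_family E C /\ Omega Q C]].
  split; first exact: finite_set1.
  + by move=> X -> C [].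
  + by move=> X -> C D [_ QC] [_ QD]; exact: subsup_reachable_all.
  move=> C QC; split=> [EC|[X [-> []]]//].
  by exists [set C | reachable flip_family E C /\ Omega Q C].
Qed.

Lemma sub_encode C : Omega P C -> C `<=` encode C.
Proof.
by move=> PC; apply: sub_retag => //; rewrite (tags_fresh q_fresh PC).
Qed.

Lemma Omega_encode C : Omega P C -> Omega Q (encode C).
Proof. by move=> PC; apply: Omega_retag Qq (OmegaS _ PC); exact: subsetUl. Qed.

(** Even for an inconsistent [C], since loops derive no fresh atom. *)
Lemma encode_consistent C : Omega P C -> consistent Q (encode C).
Proof.
move=> PC; rewrite /consistent inconsistent_retag /inconsistent => CQ.
have := Qq ([::], false); rewrite -CQ => /(derivable_over PC).
exact: q_fresh.
Qed.

Lemma same_closed_encode C : same_closed P C (encode C).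
Proof.
rewrite /same_closed closed_retag; split=> // V VP clV.
by exists V => //; apply/setIidPl.
Qed.

Lemma flip_encode a C D : Omega P C -> Omega P D -> C <> D ->
  flip_family a (encode C) (encode D) <-> retained a C D.
Proof.
move=> PC PD CD.
have flipE h : tags q (encode D) = flip h (tags q (encode C)) <->
    forall s, h s = code C s (+) code D s.
  rewrite !tags_retag //; split=> [hE s|hE].
    have : [set n | n.2 = code D n.1] (s, code D s) by [].
    by rewrite hE /flip /= => <-; case: (code D s) (h s) => [] [].
  apply/funext => -[s b]; apply/propext; rewrite /flip /= hE.
  by case: b (code C s) (code D s) => [] [] [].
split=> [[_ _ _ [l lP /flipE lE]]|eCD].
  apply: (shift_code code_isolating (@retained_on a) (@retained_sym a)
    (@retained_trans a)) lE => //.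
split; [exact: Omega_encode|exact: Omega_encode| |].
  by split=> [/encode_consistent|/encode_consistent]; case.
exists [:: (C, D)] => [z|]; first by rewrite inE => /eqP->.
by apply/flipE => s; rewrite /shift big_seq1.
Qed.

Lemma reachable_Omega B C : Omega P B -> reachable R B C -> Omega P C.
Proof.
move=> PB BC.
elim: BC PB => // {B C} [B C [a BC] _|B C D _ IH _ JH /IH/JH] //.
by rewrite -R_on_P; exact: (S5_on (us_S5 R_update_set a) BC).2.
Qed.

Lemma update_via_encode B : Omega P B ->
  update_via P (fun theta R C => supports P [::] R C theta) (fun _ => S)
    R B flip_family encode.
Proof.
move=> PB; split.
- exact: flip_update_set.
- by rewrite R_on_P; exact: subsetUl.
- by move=> C /(reachable_Omega PB); exact: Omega_encode.
- by move=> C /(reachable_Omega PB); exact: sub_encode.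
- move=> C /(reachable_Omega PB) PC theta cth; rewrite R_on_P => ath.
  rewrite !support_classical //; apply: iff_sym.
  apply: csupport_same_closed => //; first exact: subsetUl.
    exact: Omega_encode.
  exact: same_closed_encode.
- move=> a C D /(reachable_Omega PB) PC /(reachable_Omega PB) PD.
  exact: flip_encode.
Qed.

End Update.

Theorem theorem3 (U : choiceType) (A : Type) (P : set U)
    (U_uncountable : ~ countable [set: U])
    (P_countable : countable P) (P_infinite : infinite_set P)
    (R : relfam U A) (R_on_P : atoms R = P) (R_update_set : update_set P R)
    (B : base U) (B_base : Omega P B)
    (phi : formula U A) (phi_over_P : atoms_in P phi)
    (phi_supported : supports P [::] R B phi) :
  exists R' : relfam U A, effective_update P R phi B R'.
Proof.
have [code code_iso] := isolating_codes P_countable.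
have [q q_inj q_fresh] :=
  fresh_embedding (seq bool * bool)%type U_uncountable P_countable.
pose S C := supports P [::] R C phi.
exists (flip_family P R S code q), (encode code q).
have [h1 h2 h3 h4 h5 h6] := update_via_encode P_countable P_infinite R_on_P
  R_update_set S code_iso q_inj q_fresh B_base.
by split.
Qed.
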